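(* Let $p\in\{3,5,7\}$, let $\omega_p$ be the Teichmüller character modulo $p$ (a Dirichlet character modulo $p$ with values in $\mathbb{Z}_p$, with $\omega_p(m)\equiv m \pmod p$ for $p\nmid m$ and $\omega_p(m)=0$ if $p\mid m$; $\omega_p^0$ denotes the trivial character). For integers $k\ge 2$ and $0\le a,b\le p-1$ with $a\ge 1$ and $n\ge 1$ put $$c_{k,a,b,n}=\sum_{d\mid n}\omega_p^a(n/d)\,\omega_p^b(d)\,d^{k-1}\in\mathbb{Z}_p .$$ Then for all integers $n\ge 1$: (i) if $p\in\{3,5\}$, then $\tau(n)\equiv c_{k,a,b,n}\pmod p$ whenever either $a=1$ and $b+k\equiv 3\pmod{p-1}$, or $a=2$ and $b+k\equiv 2 \pmod{p-1}$; (ii) if $p=7$, then $\tau(n)\equiv c_{k,a,b,n}\pmod 7$ whenever either $a=1$ and $b+k\equiv 5\pmod 6$, or $a=4$ and $b+k\equiv 2\pmod 6$. (Moreover the constant terms agree: both $\Delta$ and the Eisenstein series $E_{k,\omega_p^a,\omega_p^b}=\sum_{n\ge1}c_{k,a,b,n}q^n$ have constant term $0$, so the $q$-expansions of $\Delta$ and $E_{k,\omega_p^a,\omega_p^b}$ are congruent modulo $p$.)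
   Context: $\tau:\mathbb{N}\to\mathbb{Z}$ is Ramanujan's tau function, defined by $\sum_{n\ge1}\tau(n)q^n=q\prod_{n\ge1}(1-q^n)^{24}$, and $\Delta=\sum_{n\ge 1}\tau(n)q^n$ is the weight-12 level-1 normalized cusp form. For Dirichlet characters $\psi,\chi$, $E_{k,\psi,\chi}$ denotes the Eisenstein series whose $n$-th Fourier coefficient ($n\ge1$) is $\sum_{d\mid n}\psi(n/d)\chi(d)d^{k-1}$ and whose constant term is $0$ when $\psi$ is nontrivial. *)

(* Defs.v *)
From HB Require Import structures.
From mathcomp Require Import all_boot all_order all_algebra.
Set Implicit Arguments. Unset Strict Implicit. Unset Printing Implicit Defensive.
Import Order.TTheory GRing.Theory Num.Theory.
Local Open Scope ring_scope.

(* Ramanujan's tau: tau n = coefficient of q^n in q * prod_{m>=1} (1-q^m)^24.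
   Factors with m > n do not affect the coefficient of q^n, so the product
   is truncated at m = n. *)
Definition tau (n : nat) : int :=
  ('X * \prod_(1 <= m < n.+1) (1 - 'X^m) ^+ 24 : {poly int})`_n.

Definition congr_mod (R : comNzRingType) (p : nat) (x y : R) : Prop :=
  exists z : R, x - y = p%:R * z.

(* omega : nat -> R is a Teichmueller character modulo p with values in R
   (R is e.g. Z_p): a completely multiplicative, p-periodic function,
   vanishing exactly on multiples of p, whose nonzero values are
   (p-1)-th roots of unity, and with omega(m) = m (mod p) for p not | m.
   (Only positive arguments are ever used.) *)
Definition teichmuller_char (R : comNzRingType) (p : nat) (omega : nat -> R)
  : Prop :=
  [/\ omega 1%N = 1,
      (forall m n : nat, omega (m * n)%N = omega m * omega n),
      (forall m : nat, omega (m + p)%N = omega m),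
      (forall m : nat, (p %| m)%N -> omega m = 0)
    & (forall m : nat, ~~ (p %| m)%N ->
         omega m ^+ p.-1 = 1 /\ congr_mod p (omega m) m%:R)].

Definition char_pow (R : comNzRingType) (p : nat) (omega : nat -> R) (a : nat)
  (m : nat) : R :=
  if a == 0%N then (if (p %| m)%N then 0 else 1) else omega m ^+ a.

Definition eis_coef (R : comNzRingType) (p : nat) (omega : nat -> R)
  (k a b n : nat) : R :=
  \sum_(d <- divisors n)
     char_pow p omega a (n %/ d) * char_pow p omega b d * (d%:R ^+ k.-1).

(* Main.v *)
(* Modulo p the Eisenstein coefficient is n sigma_1(n) for p = 3, 5 and
   n sigma_3(n) for p = 7, so everything reduces to Ramanujan's congruences for
   tau. These follow from Delta = (E_4^3 - E_6^2) / 1728 and the differential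
   equations 12 theta E_2 = E_2^2 - E_4, 3 theta E_4 = E_2 E_4 - E_6,
   2 theta E_6 = E_2 E_6 - E_4^2, where theta = q d/dq. The equations say that the
   convolutions of sigma_1, sigma_3, sigma_5 have closed forms. To see this, sum
   g(a, b) and h(a, b) over all n = a x + b y (a, b, x, y > 0), where
   h(a, b) = g(a, a + b) = g(a + b, b): the bijections
   (a, b, x, y) |-> (a, a + b, x - y, y) for x > y, and symmetrically for x < y,
   show that the sums differ only by the diagonals x = y and a = b; suitable
   polynomials h in a^2 + a b + b^2 and (a b (a + b))^2 do the job. Finally
   E_4^3 - E_6^2 and Delta both solve theta G = E_2 G, which determines G from its
   coefficient of q. Power series are handled as integer polynomials modulo X^N. *)
Require Import Defs.
From mathcomp Require Import all_boot all_order all_algebra.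
From mathcomp Require Import zify ring.
Import GRing.Theory.
Local Open Scope ring_scope.

(** * Convolutions of divisor sums *)

(* The guard matters: MathComp's [divisors 0] is [[:: 1]]. *)
Definition sigma (k n : nat) : int := \sum_(d <- divisors n | (0 < n)%N) d%:R ^+ k.

Lemma sigma0 k : sigma k 0 = 0.
Proof. by rewrite /sigma big_pred0. Qed.

Lemma sigmaE k n : (0 < n)%N -> sigma k n = \sum_(d <- divisors n) d%:R ^+ k.
Proof. by rewrite /sigma => ->. Qed.

Definition pairs {T : eqType} (s : seq T) : seq (T * T) := [seq (u, v) | u <- s, v <- s].

(* ((a, b), (x, y)) stands for a representation n = a x + b y. *)
Definition quads (n : nat) : seq ((nat * nat) * (nat * nat)) :=
  [seq q <- pairs (pairs (iota 1 n)) | q.1.1 * q.2.1 + q.1.2 * q.2.2 == n]%N.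

Lemma mem_pairs (T : eqType) (s : seq T) (u v : T) :
  ((u, v) \in pairs s) = (u \in s) && (v \in s).
Proof.
apply/allpairsP/andP => [[[u' v'] /= [us vs [-> ->]]]|[us vs]]; first by split.
by exists (u, v).
Qed.

Lemma uniq_pairs (T : eqType) (s : seq T) : uniq s -> uniq (pairs s).
Proof. by move=> us; apply: allpairs_uniq => // -[? ?] [? ?] _ _ [-> ->]. Qed.

Lemma uniq_quads n : uniq (quads n).
Proof. by rewrite filter_uniq // !uniq_pairs // iota_uniq. Qed.

Lemma mem_quads (n a b x y : nat) :
  (((a, b), (x, y)) \in quads n)
    = [&& 0 < a, 0 < b, 0 < x, 0 < y & a * x + b * y == n]%N.
Proof.
rewrite mem_filter !mem_pairs !mem_iota /=.
apply/idP/idP => [|/and5P[a0 b0 x0 y0 /eqP e]].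
  by case/and3P=> -> /andP[/andP[-> _] /andP[-> _]] /andP[/andP[-> _] /andP[-> _]].
rewrite e eqxx a0 b0 x0 y0 /=.
have := leq_pmulr a x0; have := leq_pmull x a0.
have := leq_pmulr b y0; have := leq_pmull y b0.
by lia.
Qed.

Lemma big_perm_image (T U : eqType) (s : seq T) (t : seq U) (f : T -> U)
    (F : U -> int) :
  uniq s -> uniq t -> {in s &, injective f} ->
  (forall u, reflect (exists2 v, v \in s & u = f v) (u \in t)) ->
  \sum_(u <- t) F u = \sum_(v <- s) F (f v).
Proof.
move=> us ut injf memt; rewrite -(big_map f xpredT); apply: perm_big.
apply: uniq_perm => //; first by rewrite map_inj_in_uniq.
by move=> u; apply/memt/mapP.
Qed.

(* The bijection (a, b, x, y) |-> (a, a + b, x - y, y) carries x > y to a < b. *)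
Lemma sum_quads_shift (n : nat) (g : nat -> nat -> int) :
  \sum_(q <- quads n | (q.1.1 < q.1.2)%N) g q.1.1 q.1.2
    = \sum_(q <- quads n | (q.2.2 < q.2.1)%N) g q.1.1 (q.1.1 + q.1.2)%N.
Proof.
rewrite -big_filter -[RHS]big_filter.
rewrite (@big_perm_image _ _ [seq q <- quads n | (q.2.2 < q.2.1)%N] _
  (fun q => ((q.1.1, q.1.1 + q.1.2), (q.2.1 - q.2.2, q.2.2)))%N) //=.
- by rewrite filter_uniq // uniq_quads.
- by rewrite filter_uniq // uniq_quads.
- move=> [[a b] [x y]] [[a' b'] [x' y']]; rewrite !mem_filter /= => /andP[xy _] /andP[xy' _].
  move=> [-> eb ex ey]; subst y'.
  by have [-> ->] : b = b' /\ x = x' by lia.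
- move=> [[a b] [x y]]; rewrite mem_filter mem_quads /=.
  apply: (iffP idP) => [/and5P[ab a0 b0 x0 /andP[y0 /eqP e]]|].
    exists ((a, b - a), (x + y, y))%N.
      rewrite mem_filter mem_quads /= a0 y0; apply/and5P; split=> //; lia.
    by rewrite /= subnKC 1?ltnW // addnK.
  move=> [[[a' b'] [x' y']]]; rewrite mem_filter mem_quads /=.
  case/and5P=> xy a0 b0 x0 /andP[y0 /eqP e] [-> -> -> ->].
  by have := leq_mul (leqnn a') (ltnW xy); lia.
Qed.

Lemma sum_quads_sym (n : nat) (F : nat -> nat -> nat -> nat -> int) :
  \sum_(q <- quads n) F q.1.1 q.1.2 q.2.1 q.2.2
    = \sum_(q <- quads n) F q.1.2 q.1.1 q.2.2 q.2.1.
Proof.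
rewrite (@big_perm_image _ _ (quads n) _
  (fun q => ((q.1.2, q.1.1), (q.2.2, q.2.1)))) ?uniq_quads //=.
- by move=> [[a b] [x y]] [[a' b'] [x' y']] _ _ [-> -> -> ->].
- move=> [[a b] [x y]]; rewrite mem_quads; apply: (iffP idP).
    case/and5P=> a0 b0 x0 y0 e; exists ((b, a), (y, x)) => //.
    by rewrite mem_quads a0 b0 x0 y0 addnC.
  move=> [[[a' b'] [x' y']]]; rewrite mem_quads.
  by case/and5P=> a0 b0 x0 y0 e [-> -> -> ->]; rewrite a0 b0 x0 y0 addnC.
Qed.

Lemma sum_quads_transfer (n : nat) (g h : nat -> nat -> int) :
  (forall a b, g a (a + b)%N = h a b) -> (forall a b, g (a + b)%N b = h a b) ->
  \sum_(q <- quads n) (h q.1.1 q.1.2 - g q.1.1 q.1.2)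
    = \sum_(q <- quads n | q.2.1 == q.2.2) h q.1.1 q.1.2
      - \sum_(q <- quads n | q.1.1 == q.1.2) g q.1.1 q.1.2.
Proof.
move=> gh1 gh2; rewrite sumrB.
have tri (F : nat * nat * (nat * nat) -> int) (u v : nat * nat * (nat * nat) -> nat) :
    \sum_(q <- quads n) F q = \sum_(q <- quads n | (u q < v q)%N) F q
     + \sum_(q <- quads n | (v q < u q)%N) F q + \sum_(q <- quads n | u q == v q) F q.
  rewrite (bigID (fun q => u q < v q)%N) /= -addrA; congr (_ + _).
  rewrite (bigID (fun q => v q < u q)%N) /=; congr (_ + _); apply: eq_bigl => q; lia.
rewrite (tri _ (fun q => q.2.1) (fun q => q.2.2)).
rewrite (tri (fun q => g _ _) (fun q => q.1.1) (fun q => q.1.2)).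
(* Exchanging (a, x) with (b, y) carries the part a > b to a < b, so the shift handles it too, and
   only the diagonals survive. *)
have -> : \sum_(q <- quads n | (q.1.2 < q.1.1)%N) g q.1.1 q.1.2
    = \sum_(q <- quads n | (q.2.1 < q.2.2)%N) h q.1.1 q.1.2.
  rewrite big_mkcond (sum_quads_sym n (fun a b _ _ => if (b < a)%N then g a b else 0)).
  rewrite -big_mkcond (sum_quads_shift n (fun a b => g b a)).
  rewrite big_mkcond (sum_quads_sym n (fun a b x y => if (y < x)%N then g (a + b)%N a else 0)).
  by rewrite -big_mkcond; apply: eq_bigr => q _; rewrite addnC gh2.
rewrite (sum_quads_shift n g).
under [X in _ - (X + _ + _) = _]eq_bigr => q _ do rewrite gh1.
by ring.
Qed.

(** If x = y then n = (a + b) x, so d = a + b runs through the divisors of n and a through 1, ..., d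
    - 1. *)
Lemma sum_quads_diag_xy (n : nat) (h : nat -> nat -> int) : (0 < n)%N ->
  \sum_(q <- quads n | q.2.1 == q.2.2) h q.1.1 q.1.2
    = \sum_(d <- divisors n) \sum_(1 <= a < d) h a (d - a)%N.
Proof.
move=> n0.
rewrite -big_filter.
rewrite (@big_perm_image _ _ [seq (d, a) | d <- divisors n, a <- index_iota 1 d] _
  (fun r => ((r.2, r.1 - r.2), (n %/ r.1, n %/ r.1)))%N) //=.
- by rewrite big_allpairs_dep.
- apply: allpairs_uniq_dep; rewrite ?divisors_uniq //.
    by move=> *; rewrite iota_uniq.
  by move=> [? ?] [? ?] _ _ /= [-> ->].
- by rewrite filter_uniq // uniq_quads.
- move=> r r' /allpairsPdep[d [a [_ + ->]]] /allpairsPdep[d' [a' [_ + ->]]] /=.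
  rewrite !mem_index_iota => /andP[a0 ad] /andP[a0' ad'] [-> e _].
  by have -> : d = d' by lia.
- move=> [[a b] [x y]]; rewrite mem_filter mem_quads /=; apply: (iffP idP).
    case/and5P=> /eqP <- a0 b0 x0 /andP[_ /eqP e].
    exists (a + b, a)%N.
      apply/allpairsPdep; exists (a + b)%N, a; split=> //.
        by rewrite -dvdn_divisors // -e -mulnDl dvdn_mulr.
      by rewrite mem_index_iota a0 /=; lia.
    by rewrite /= addKn -e -mulnDl mulKn // addn_gt0 a0.
  move=> [r /allpairsPdep[d [a' [dn + ->]]] /= [-> -> -> ->]].
  rewrite mem_index_iota eqxx => /andP[a0 ad]; rewrite -dvdn_divisors // in dn.
  rewrite a0 subn_gt0 ad divn_gt0 ?(dvdn_leq n0 dn) /=; last by lia.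
  by rewrite -mulnDl subnKC 1?ltnW // mulnC divnK.
Qed.

(** If a = b = d then x + y = n / d, which has n / d - 1 solutions in positive x and y. *)
Lemma sum_quads_diag_ab (n : nat) (g : nat -> nat -> int) : (0 < n)%N ->
  \sum_(q <- quads n | q.1.1 == q.1.2) g q.1.1 q.1.2
    = \sum_(d <- divisors n) (n %/ d).-1%:R * g d d.
Proof.
move=> n0; rewrite -big_filter.
rewrite (@big_perm_image _ _ [seq (d, x) | d <- divisors n, x <- index_iota 1 (n %/ d)] _
  (fun r => ((r.1, r.1), (r.2, n %/ r.1 - r.2)))%N) //=.
- rewrite big_allpairs_dep; apply: eq_bigr => d _ /=.
  by rewrite big_const_nat iter_addr addr0 subn1 mulr_natl.
- apply: allpairs_uniq_dep; rewrite ?divisors_uniq //.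
    by move=> *; rewrite iota_uniq.
  by move=> [? ?] [? ?] _ _ /= [-> ->].
- by rewrite filter_uniq // uniq_quads.
- by move=> [? ?] [? ?] _ _ /= [-> _ -> _].
- move=> [[a b] [x y]]; rewrite mem_filter mem_quads /=; apply: (iffP idP).
    case/and5P=> /eqP <- a0 _ x0 /andP[y0 /eqP e].
    exists (a, x).
      apply/allpairsPdep; exists a, x; split=> //.
        by rewrite -dvdn_divisors // -e -mulnDr dvdn_mulr.
      by rewrite mem_index_iota x0 -e -mulnDr mulKn //; lia.
    by rewrite /= -e -mulnDr mulKn // addKn.
  move=> [r /allpairsPdep[d [x' [dn + ->]]] /= [-> -> -> ->]].
  rewrite mem_index_iota eqxx => /andP[a0 ad]; rewrite -dvdn_divisors // in dn.
  rewrite (dvdn_gt0 n0 dn) a0 subn_gt0 ad /=.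
  by rewrite -mulnDr subnKC 1?ltnW // mulnC divnK.
Qed.

(** A divisor a of j and a divisor b of n - j give j = a x and n - j = b y. The ends j = 0 and j = n
    contribute nothing on either side, as [sigma] vanishes at 0 and a, b, x, y are positive. *)
Lemma sigma_conv (i k n : nat) :
  \sum_(j < n.+1) sigma i j * sigma k (n - j)
    = \sum_(q <- quads n) q.1.1%:R ^+ i * q.1.2%:R ^+ k.
Proof.
have -> : \sum_(q <- quads n) q.1.1%:R ^+ i * q.1.2%:R ^+ k
  = \sum_(q <- quads n) \sum_(j < n.+1 | (j == q.1.1 * q.2.1 :> nat)%N)
      (q.1.1%:R ^+ i * q.1.2%:R ^+ k : int).
  rewrite big_seq [RHS]big_seq; apply: eq_bigr => -[[a b] [x y]].
  rewrite mem_quads /= => /and5P[_ _ _ _ /eqP e].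
  have lt : (a * x < n.+1)%N by rewrite -e ltnS leq_addr.
  by rewrite (big_pred1 (Ordinal lt)).
rewrite (exchange_big_dep xpredT) //=; apply: eq_bigr => j _.
have [j0|j0] := posnP j.
  rewrite j0 sigma0 mul0r big1_seq // => -[[a b] [x y]] /=.
  by rewrite mem_quads eq_sym muln_eq0 !eqn0Ngt => /andP[ax /and5P[a0 _ x0 _ _]];
    rewrite a0 x0 in ax.
have [nj0|nj0] := posnP (n - j).
  rewrite nj0 sigma0 mulr0 big1_seq // => -[[a b] [x y]] /=.
  rewrite mem_quads => /andP[/eqP ej /and5P[a0 b0 x0 y0 /eqP e]].
  by move: nj0; rewrite ej -[X in (X - _)%N]e addKn => /eqP; rewrite muln_eq0 !eqn0Ngt b0 y0.
rewrite !sigmaE // big_distrlr /= -[RHS]big_filter.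
transitivity (\sum_(r <- [seq (d, e) | d <- divisors j, e <- divisors (n - j)])
  (r.1%:R ^+ i * r.2%:R ^+ k : int)); first by rewrite big_allpairs.
symmetry; apply: (@big_perm_image _ _ _ _
  (fun r => ((r.1, r.2), (j %/ r.1, (n - j) %/ r.2)))%N) => //=.
- by apply: allpairs_uniq; rewrite ?divisors_uniq // => -[? ?] [? ?].
- by rewrite filter_uniq // uniq_quads.
- by move=> [? ?] [? ?] _ _ /= [-> ->].
- move=> [[a b] [x y]]; rewrite mem_filter mem_quads /=; apply: (iffP idP).
    case/and5P=> /eqP ej a0 b0 x0 /andP[y0 /eqP e].
    have ej' : (n - j)%N = (b * y)%N by rewrite ej -[X in (X - _)%N]e addKn.
    exists (a, b); last by rewrite ej' ej !mulKn.
    apply/allpairsP; exists (a, b); split => //=.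
      by rewrite -dvdn_divisors ?ej ?dvdn_mulr // muln_gt0 a0.
    by rewrite -dvdn_divisors ?ej' ?dvdn_mulr // muln_gt0 b0.
  move=> [r /allpairsP[[d e] /= [dj en ->]] /= [-> -> -> ->]].
  rewrite -!dvdn_divisors // in dj en.
  rewrite !divn_gt0 ?(dvdn_gt0 j0 dj) ?(dvdn_gt0 nj0 en) //.
  rewrite (dvdn_leq j0 dj) (dvdn_leq nj0 en) ![(_ * (_ %/ _))%N]mulnC !divnK // eqxx /=.
  by rewrite subnKC // -ltnS.
Qed.

Lemma sum_quads_divisors (n : nat) (g h : nat -> nat -> int) : (0 < n)%N ->
  (forall a b, g a (a + b)%N = h a b) -> (forall a b, g (a + b)%N b = h a b) ->
  \sum_(q <- quads n) (h q.1.1 q.1.2 - g q.1.1 q.1.2)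
    = \sum_(d <- divisors n)
        (\sum_(1 <= a < d) h a (d - a)%N - (n %/ d).-1%:R * g d d).
Proof.
move=> n0 gh1 gh2.
by rewrite (sum_quads_transfer n g h) // sum_quads_diag_xy // sum_quads_diag_ab // -sumrB.
Qed.

(** Telescoping: F is a discrete antiderivative of c s, and c clears the denominators of Faulhaber's
    formulas. *)
Lemma sum_nat_antidiff (s F : int -> int) (c : int) (m : nat) :
  F 1 = 0 -> (forall a : nat, F a.+1%:R = F a%:R + c * s a%:R) -> (0 < m)%N ->
  c * \sum_(1 <= a < m) s a%:R = F m%:R.
Proof.
move=> F1 FS; case: m => // m _; elim: m => [|m IHm].
  by rewrite big_geq // mulr0 F1.
by rewrite big_nat_recr //= mulrDr IHm [RHS]FS.
Qed.

(* The next three forms are h(a, d - a) for the h that are invariant under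
   (a, b) |-> (a + b, -a); the coefficients 42 and 747 in degree 6 are those
   which make sigma_7 disappear from the resulting convolution identity. *)
Lemma sum_form2 (d : nat) : (0 < d)%N ->
  6 * \sum_(1 <= a < d) (a%:R ^+ 2 + a%:R * (d - a)%N%:R + (d - a)%N%:R ^+ 2 : int)
    = 5 * d%:R ^+ 3 + d%:R - 6 * d%:R ^+ 2.
Proof.
move=> d0; under eq_big_nat => a /andP[_ ad] do rewrite natrB 1?ltnW //.
set D : int := d%:R.
(* The form equals D^2 - a D + a^2; each power of a is summed by Faulhaber's formula. The next two
   lemmas obtain their antiderivatives in the same way. *)
rewrite (sum_nat_antidiff (fun a => a ^+ 2 + a * (D - a) + (D - a) ^+ 2)
  (fun m => 6 * (m - 1) * D ^+ 2 - 3 * m * (m - 1) * D + m * (m - 1) * (2 * m - 1))) //.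
- by rewrite -/D; ring.
- by ring.
- by move=> a; rewrite -natr1; ring.
Qed.

Lemma sum_form4 (d : nat) : (0 < d)%N ->
  30 * \sum_(1 <= a < d) ((a%:R ^+ 2 + a%:R * (d - a)%N%:R + (d - a)%N%:R ^+ 2) ^+ 2 : int)
    = 21 * d%:R ^+ 5 + 10 * d%:R ^+ 3 - d%:R - 30 * d%:R ^+ 4.
Proof.
move=> d0; under eq_big_nat => a /andP[_ ad] do rewrite natrB 1?ltnW //.
set D : int := d%:R.
rewrite (sum_nat_antidiff (fun a => (a ^+ 2 + a * (D - a) + (D - a) ^+ 2) ^+ 2)
  (fun m => 30 * (m - 1) * D ^+ 4 - 30 * m * (m - 1) * D ^+ 3
    + 15 * m * (m - 1) * (2 * m - 1) * D ^+ 2 - 15 * m ^+ 2 * (m - 1) ^+ 2 * D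
    + m * (m - 1) * (2 * m - 1) * (3 * m ^+ 2 - 3 * m - 1))) //.
- by rewrite -/D; ring.
- by ring.
- by move=> a; rewrite -natr1; ring.
Qed.

Lemma sum_form6 (d : nat) : (0 < d)%N ->
  2 * \sum_(1 <= a < d)
     (42 * (a%:R ^+ 2 + a%:R * (d - a)%N%:R + (d - a)%N%:R ^+ 2) ^+ 3
      - 747 * (a%:R * (d - a)%N%:R * (a%:R + (d - a)%N%:R)) ^+ 2 : int)
    = 2 * (d%:R + 21 * d%:R ^+ 5 + 20 * d%:R ^+ 3 - 42 * d%:R ^+ 6).
Proof.
move=> d0; under eq_big_nat => a /andP[_ ad] do rewrite natrB 1?ltnW //.
set D : int := d%:R.
rewrite (sum_nat_antidiff (fun a => 42 * (a ^+ 2 + a * (D - a) + (D - a) ^+ 2) ^+ 3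
      - 747 * (a * (D - a) * (a + (D - a))) ^+ 2)
  (fun m => 84 * (m - 1) * D ^+ 6 - 126 * m * (m - 1) * D ^+ 5
    - 165 * m * (m - 1) * (2 * m - 1) * D ^+ 4 + 600 * m ^+ 2 * (m - 1) ^+ 2 * D ^+ 3
    - 33 * m * (m - 1) * (2 * m - 1) * (3 * m ^+ 2 - 3 * m - 1) * D ^+ 2
    - 21 * m ^+ 2 * (m - 1) ^+ 2 * (2 * m ^+ 2 - 2 * m - 1) * D
    + 2 * m * (m - 1) * (2 * m - 1) * (3 * m ^+ 4 - 6 * m ^+ 3 + 3 * m + 1))) //.
- by rewrite -/D; ring.
- by ring.
- by move=> a; rewrite -natr1; ring.
Qed.

(** Every g(d, d) below is a multiple of d, so this turns the weight n / d - 1 of the diagonal a = b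
    into n - d; the n becomes the theta term of the differential equation. *)
Lemma natr_pred_quotient (n d : nat) : (0 < n)%N -> d \in divisors n ->
  (n %/ d).-1%:R * d%:R = n%:R - d%:R :> int.
Proof.
move=> n0; rewrite -dvdn_divisors // => dn.
have q0 : (0 < n %/ d)%N by rewrite divn_gt0 ?(dvdn_leq n0) // (dvdn_gt0 n0).
by rewrite -subn1 natrB // mulrBl mul1r -natrM divnK.
Qed.

(** * The three convolution identities *)

Lemma sigma_conv11 (n : nat) :
  12 * (\sum_(j < n.+1) sigma 1 j * sigma 1 (n - j))
    = 5 * sigma 3 n + sigma 1 n - 6 * (n%:R * sigma 1 n).
Proof.
have [->|n0] := posnP n; first by rewrite big_ord1 !sigma0; ring.
pose h a b : int := a%:R ^+ 2 + a%:R * b%:R + b%:R ^+ 2.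
(* Here and in the next two lemmas g(a, b) = h(a, -b); in this case h - g = 2 a b. *)
pose g a b : int := a%:R ^+ 2 - a%:R * b%:R + b%:R ^+ 2.
have gh1 a b : g a (a + b)%N = h a b by rewrite /g /h natrD; ring.
have gh2 a b : g (a + b)%N b = h a b by rewrite /g /h natrD; ring.
have E := sum_quads_divisors n g h n0 gh1 gh2.
rewrite sigma_conv !sigmaE //.
transitivity (6 * \sum_(q <- quads n) (h q.1.1 q.1.2 - g q.1.1 q.1.2)).
  by rewrite !mulr_sumr; apply: eq_bigr => q _; rewrite /h /g; ring.
rewrite E !mulr_sumr -big_split -sumrB; apply: eq_big_seq => d dn /=.
have d0 : (0 < d)%N by rewrite (@dvdn_gt0 _ n) // dvdn_divisors.
rewrite mulrBr sum_form2 // /g.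
have := natr_pred_quotient n d n0 dn; move: (_.-1%:R) (d%:R) (n%:R) => N D K e.
have -> : K = N * D + D by rewrite e subrK.
by ring.
Qed.

Lemma sigma_conv13 (n : nat) :
  240 * (\sum_(j < n.+1) sigma 1 j * sigma 3 (n - j))
    = 21 * sigma 5 n + 10 * sigma 3 n - sigma 1 n - 30 * (n%:R * sigma 3 n).
Proof.
have [->|n0] := posnP n; first by rewrite big_ord1 !sigma0; ring.
pose h a b : int := (a%:R ^+ 2 + a%:R * b%:R + b%:R ^+ 2) ^+ 2.
pose g a b : int := (a%:R ^+ 2 - a%:R * b%:R + b%:R ^+ 2) ^+ 2.
have gh1 a b : g a (a + b)%N = h a b by rewrite /g /h natrD; ring.
have gh2 a b : g (a + b)%N b = h a b by rewrite /g /h natrD; ring.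
have E := sum_quads_divisors n g h n0 gh1 gh2.
rewrite sigma_conv !sigmaE //.
transitivity (30 * \sum_(q <- quads n) (h q.1.1 q.1.2 - g q.1.1 q.1.2)).
  (* Since h - g = 4 (a^3 b + a b^3), half of the convolution is needed with a and b exchanged. *)
  rewrite (_ : 240 = 120 + 120) // mulrDl.
  rewrite [X in _ + _ * X](sum_quads_sym n (fun a b _ _ => a%:R ^+ 1 * b%:R ^+ 3)).
  by rewrite !mulr_sumr -big_split; apply: eq_bigr => q _; rewrite /h /g /=; ring.
rewrite E !mulr_sumr -big_split -!sumrB; apply: eq_big_seq => d dn /=.
have d0 : (0 < d)%N by rewrite (@dvdn_gt0 _ n) // dvdn_divisors.
rewrite mulrBr sum_form4 // /g.
have := natr_pred_quotient n d n0 dn; move: (_.-1%:R) (d%:R) (n%:R) => N D K e.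
have -> : K = N * D + D by rewrite e subrK.
by ring.
Qed.

Lemma sigma_conv15_33 (n : nat) :
  504 * (\sum_(j < n.+1) sigma 1 j * sigma 5 (n - j))
  - 2400 * (\sum_(j < n.+1) sigma 3 j * sigma 3 (n - j))
    = sigma 1 n + 21 * sigma 5 n + 20 * sigma 3 n - 42 * (n%:R * sigma 5 n).
Proof.
have [->|n0] := posnP n; first by rewrite !big_ord1 !sigma0; ring.
pose h a b : int := 42 * (a%:R ^+ 2 + a%:R * b%:R + b%:R ^+ 2) ^+ 3
  - 747 * (a%:R * b%:R * (a%:R + b%:R)) ^+ 2.
pose g a b : int := 42 * (a%:R ^+ 2 - a%:R * b%:R + b%:R ^+ 2) ^+ 3
  - 747 * (a%:R * b%:R * (a%:R - b%:R)) ^+ 2.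
have gh1 a b : g a (a + b)%N = h a b by rewrite /g /h natrD; ring.
have gh2 a b : g (a + b)%N b = h a b by rewrite /g /h natrD; ring.
have E := sum_quads_divisors n g h n0 gh1 gh2.
rewrite !sigma_conv !sigmaE //.
transitivity (\sum_(q <- quads n) (h q.1.1 q.1.2 - g q.1.1 q.1.2)).
  (* Here h - g = 252 (a^5 b + a b^5) - 2400 a^3 b^3. *)
  rewrite (_ : 504 = 252 + 252) // mulrDl.
  rewrite [X in _ + _ * X - _](sum_quads_sym n (fun a b _ _ => a%:R ^+ 1 * b%:R ^+ 5)).
  by rewrite !mulr_sumr -big_split -sumrB; apply: eq_bigr => q _; rewrite /h /g /=; ring.
rewrite E !mulr_sumr -!big_split -sumrB; apply: eq_big_seq => d dn /=.
have d0 : (0 < d)%N by rewrite (@dvdn_gt0 _ n) // dvdn_divisors.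
(* [sum_form6] evaluates twice the sum, its antiderivative being integral only after doubling. *)
apply: (@mulfI _ (2 : int)) => //.
rewrite [LHS]mulrBr sum_form6 // /g.
have := natr_pred_quotient n d n0 dn; move: (_.-1%:R) (d%:R) (n%:R) => N D K e.
have -> : K = N * D + D by rewrite e subrK.
by ring.
Qed.

(** * Ramanujan's differential equations *)

(** Truncation errors are carried as explicit multiples of X^N, so that congruences modulo X^N
    become equations open to [ring]. *)
Lemma eq_coef_modXn (N : nat) (f g : {poly int}) :
  (forall i, (i < N)%N -> f`_i = g`_i) <-> exists r, f = g + 'X^N * r.
Proof.
split=> [fg|[r ->] i iN]; last by rewrite coefD coefXnM iN addr0.
exists (drop_poly N (f - g)); rewrite -[LHS](subrK g) addrC; congr (_ + _).
rewrite -{1}(poly_take_drop N (f - g)) mulrC.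
have -> : take_poly N (f - g) = 0; last by rewrite add0r.
apply/polyP => i; rewrite coef_take_poly coefB coef0.
by case: ifP => // /fg ->; rewrite subrr.
Qed.

Lemma coef_natM (c : nat) (f : {poly int}) n : (c%:R * f)`_n = c%:R * f`_n.
Proof. by rewrite !mulr_natl coefMn. Qed.

Definition theta (f : {poly int}) : {poly int} := 'X * f^`().

Lemma coef_theta f n : (theta f)`_n = n%:R * f`_n.
Proof. by rewrite coefXM; case: n => [|n]; rewrite ?mul0r // coef_deriv mulr_natl. Qed.

Lemma thetaD f g : theta (f + g) = theta f + theta g.
Proof. by rewrite /theta derivD mulrDr. Qed.

Lemma thetaB f g : theta (f - g) = theta f - theta g.
Proof. by rewrite /theta derivB mulrBr. Qed.

Lemma thetaM f g : theta (f * g) = theta f * g + f * theta g.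
Proof. by rewrite /theta derivM; ring. Qed.

Lemma theta_nat n : theta n%:R = 0.
Proof. by rewrite /theta -polyC_natr derivC mulr0. Qed.

Lemma thetaX f n : theta (f ^+ n) = n%:R * f ^+ n.-1 * theta f.
Proof. by rewrite /theta deriv_exp -mulr_natl; ring. Qed.

Lemma theta_Xn n : theta 'X^n = n%:R * 'X^n.
Proof.
apply/polyP => i; rewrite coef_theta coef_natM coefXn.
by case: eqP => [->|]; rewrite ?mulr0.
Qed.

Lemma theta_mulXn N f : theta ('X^N * f) = 'X^N * (N%:R * f + theta f).
Proof. by rewrite thetaM theta_Xn; ring. Qed.

Definition sigma_poly (N k : nat) : {poly int} := \poly_(i < N) sigma k i.

Lemma coef_sigma_polyM N i k n : (n < N)%N ->
  (sigma_poly N i * sigma_poly N k)`_n = \sum_(j < n.+1) sigma i j * sigma k (n - j).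
Proof.
move=> nN; rewrite coefM; apply: eq_bigr => j _.
by rewrite !coef_poly (leq_ltn_trans (leq_subr _ _) nN) (leq_ltn_trans _ nN) // -ltnS.
Qed.

(** With E_2 = 1 - 24 A, E_4 = 1 + 240 B, E_6 = 1 - 504 C, where A, B, C generate sigma_1, sigma_3,
    sigma_5, this is Ramanujan's equation for E_2 divided by -48. The next two are those for E_4 and
    E_6 divided by 24 and -24. *)
Lemma theta_sigma1 N : exists r,
  12 * (sigma_poly N 1 * sigma_poly N 1) = 5 * sigma_poly N 3 + sigma_poly N 1
    - 6 * theta (sigma_poly N 1) + 'X^N * r.
Proof.
apply/eq_coef_modXn => n nN.
rewrite !(coefB, coefD, coef_natM, coef_sigma_polyM, coef_theta) //.
by rewrite !coef_poly nN sigma_conv11.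
Qed.

Lemma theta_sigma3 N : exists r,
  240 * (sigma_poly N 1 * sigma_poly N 3) = 21 * sigma_poly N 5 + 10 * sigma_poly N 3
    - sigma_poly N 1 - 30 * theta (sigma_poly N 3) + 'X^N * r.
Proof.
apply/eq_coef_modXn => n nN.
rewrite !(coefB, coefD, coef_natM, coef_sigma_polyM, coef_theta) //.
by rewrite !coef_poly nN sigma_conv13.
Qed.

Lemma theta_sigma5 N : exists r,
  504 * (sigma_poly N 1 * sigma_poly N 5) - 2400 * (sigma_poly N 3 * sigma_poly N 3)
    = sigma_poly N 1 + 21 * sigma_poly N 5 + 20 * sigma_poly N 3
    - 42 * theta (sigma_poly N 5) + 'X^N * r.
Proof.
apply/eq_coef_modXn => n nN.
rewrite !(coefB, coefD, coef_natM, coef_sigma_polyM, coef_theta) //.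
by rewrite !coef_poly nN sigma_conv15_33.
Qed.

(** * The product for Delta, its logarithmic derivative, and its expression in E_4 and E_6 *)

Definition Delta_poly (N : nat) : {poly int} :=
  'X * \prod_(1 <= m < N) (1 - 'X^m) ^+ 24.

(** For N > 0 the product telescopes to X^K - X^(K N), and K N is at least N. *)
Lemma geometric_modXn (K N : nat) : (0 < K)%N -> exists s : {poly int},
  (1 - 'X^K) * \sum_(1 <= j < N) 'X^(K * j) = 'X^K + 'X^N * s.
Proof.
move=> K0; case: N => [|N].
  by exists (- 'X^K); rewrite big_geq // expr0; ring.
exists (- 'X^(K * N.+1 - N.+1)).
have -> : 'X^(N.+1) * - 'X^(K * N.+1 - N.+1) = - 'X^(K * N.+1) :> {poly int}.
  by rewrite mulrN -exprD subnKC // leq_pmull.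
elim: N => [|N IHN]; first by rewrite big_geq // muln1; ring.
by rewrite big_nat_recr //= mulrDr IHN [(K * N.+2)%N]mulnS exprD; ring.
Qed.

(* Logarithmic differentiation, with m X^m / (1 - X^m) truncated to
   m (X^m + X^(2m) + ...). *)
Lemma theta_euler_prod (N K : nat) : exists r,
  theta (\prod_(1 <= m < K) (1 - 'X^m) ^+ 24)
  = - 24 * (\prod_(1 <= m < K) (1 - 'X^m) ^+ 24)
      * (\sum_(1 <= m < K) m%:R * \sum_(1 <= j < N) 'X^(m * j)) + 'X^N * r.
Proof.
elim: K => [|K [r IHK]].
  by exists 0; rewrite !big_geq // (theta_nat 1); ring.
have [->|K0] := posnP K.
  by exists 0; rewrite !big_geq // (theta_nat 1); ring.
rewrite !big_nat_recr //=; set E := \prod_(1 <= m < K) _ in IHK *.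
set S := \sum_(1 <= m < K) _ in IHK *.
have theta1 : theta 1 = 0 by exact: (theta_nat 1).
rewrite thetaM IHK thetaX thetaB theta_Xn theta1 /=.
have [s ts] := geometric_modXn K N K0.
set T := \sum_(1 <= j < N) _ in ts *.
set Z := 1 - 'X^K in ts *.
(* Trading X^K for Z T restores the factor Z lost in differentiating Z^24; the error s then enters
   with weight 24 K E Z^23. *)
have -> : 'X^K = Z * T - 'X^N * s by rewrite ts; ring.
exists (r * Z ^+ 24 + 24 * K%:R * E * Z ^+ 23 * s).
by move: Z => Z in ts *; ring.
Qed.

(** Lambert series: the coefficient of X^n collects m over the factorizations n = m j, and for 0 < n
    < N both factors lie below N. *)
Lemma sigma1_lambert (N : nat) :
  exists r, \sum_(1 <= m < N) m%:R * \sum_(1 <= j < N) 'X^(m * j)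
    = sigma_poly N 1 + 'X^N * r :> {poly int}.
Proof.
apply/eq_coef_modXn => n nN; rewrite coef_poly nN coef_sum.
have coefS m : (m%:R * \sum_(1 <= j < N) 'X^(m * j) : {poly int})`_n
    = m%:R * \sum_(1 <= j < N) (n == m * j)%N%:R.
  by rewrite coef_natM coef_sum; congr (_ * _); apply: eq_bigr => j _; rewrite coefXn.
have [n0|n0] := posnP n.
  have -> : sigma 1 n = 0 by rewrite n0 sigma0.
  rewrite big_nat_cond big1 // => m /andP[/andP[m0 _] _].
  rewrite coefS n0 big_nat_cond big1 ?mulr0 // => j /andP[/andP[j0 _] _].
  by rewrite eq_sym muln_eq0 !eqn0Ngt m0 j0.
rewrite sigmaE //.
transitivity (\sum_(m <- index_iota 1 N | (m %| n)%N) m%:R ^+ 1 : int).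
  rewrite [RHS]big_mkcond; apply: eq_big_nat => m /andP[m0 _]; rewrite coefS expr1.
  case: ifP => mn; last first.
    rewrite big1 ?mulr0 // => j _; case: eqP => // e.
    by rewrite e dvdn_mulr in mn.
  have q0 : (0 < n %/ m)%N by rewrite divn_gt0 // dvdn_leq.
  rewrite (bigD1_seq (n %/ m)%N) ?iota_uniq ?mem_index_iota ?q0
    ?(leq_ltn_trans (leq_div _ _) nN) //=.
  rewrite mulnC divnK // eqxx big1 ?addr0 ?mulr1 // => j jq; case: eqP => // e.
  by rewrite e mulKn // eqxx in jq.
rewrite -big_filter; apply: perm_big; apply: uniq_perm.
- by rewrite filter_uniq // iota_uniq.
- exact: divisors_uniq.
move=> d; rewrite mem_filter mem_index_iota -dvdn_divisors //.
apply: andb_idr => dn; rewrite (dvdn_gt0 n0 dn) /=.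
exact: leq_ltn_trans (dvdn_leq n0 dn) nN.
Qed.

Lemma theta_Delta (N : nat) : exists r,
  theta (Delta_poly N) = (1 - 24 * sigma_poly N 1) * Delta_poly N + 'X^N * r.
Proof.
have [r E] := theta_euler_prod N N; have [s L] := sigma1_lambert N.
rewrite L in E; rewrite /Delta_poly thetaM E.
have -> : theta 'X = 'X by rewrite /theta derivX mulr1.
set P := \prod_(1 <= m < N) _; exists ('X * (r - 24 * P * s)); ring.
Qed.

(** Comparing coefficients of X^i and using P_0 = 1 expresses (i - 1) G_i through earlier
    coefficients, so induction applies; the exceptional index i = 1 is covered by G_1 = 0. *)
Lemma eq0_modXn_of_theta (N : nat) (P G r : {poly int}) :
  P`_0 = 1 -> G`_1 = 0 -> theta G = P * G + 'X^N * r ->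
  forall i, (i < N)%N -> G`_i = 0.
Proof.
move=> P0 G1 GP i; elim/ltn_ind: i => -[|[|i]] IHi iN //.
  have := congr1 (fun f : {poly int} => f`_0) GP.
  by rewrite /theta coefXM coefD coefXnM iN coef0M P0 mul1r addr0 => <-.
have := congr1 (fun f : {poly int} => f`_i.+2) GP.
rewrite coef_theta coefD coefXnM iN addr0 coefM big_ord_recl P0 mul1r subn0.
rewrite big1 => [|j _]; last first.
  by rewrite [X in _ * X]IHi ?mulr0 // lift0; move: (ltn_ord j) iN; lia.
rewrite addr0 -natr1 mulrDl mul1r -[X in _ = X]add0r => /addIr /eqP.
by rewrite mulf_eq0 => /orP[|/eqP] //; rewrite Num.Theory.pnatr_eq0.
Qed.

Lemma coef1_Delta N : (Delta_poly N)`_1 = 1.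
Proof.
rewrite coefXM /= -horner_coef0 horner_prod big_nat big1 // => m /andP[m0 _].
by rewrite !hornerE expr0n; case: m m0 => // m _; rewrite subr0 expr1n.
Qed.

(* Both sides solve theta G = E_2 G and have the same leading coefficient 1728. *)
Lemma Delta_E4_E6 (N : nat) : (1 < N)%N -> exists r,
  1728 * Delta_poly N = (1 + 240 * sigma_poly N 3) ^+ 3
    - (1 - 504 * sigma_poly N 5) ^+ 2 + 'X^N * r.
Proof.
move=> N1; apply/eq_coef_modXn.
have [u Eu] := theta_sigma3 N; have [v Ev] := theta_sigma5 N.
have [w Ew] := theta_Delta N.
set A := sigma_poly N 1 in Eu Ev Ew *; set B := sigma_poly N 3 in Eu Ev *.
set C := sigma_poly N 5 in Eu Ev *; set D := Delta_poly N in Ew *.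
set G := 1728 * D - ((1 + 240 * B) ^+ 3 - (1 - 504 * C) ^+ 2).
have c0 k : (sigma_poly N k)`_0 = 0.
  by rewrite coef_poly sigma0 if_same.
have c1 k : (sigma_poly N k)`_1 = 1.
  by rewrite coef_poly N1 sigmaE // -[divisors 1]/[:: 1%N] big_seq1 expr1n.
suff G0 : forall i, (i < N)%N -> G`_i = 0.
  by move=> i /G0 /eqP; rewrite coefB subr_eq0 => /eqP.
(* The errors w, u, v carry the weights with which theta D, 30 theta B and 42 theta C occur in theta
   G. *)
pose t := 1728 * w - 24 * (1 + 240 * B) ^+ 2 * u - 24 * (1 - 504 * C) * v.
apply: (@eq0_modXn_of_theta N (1 - 24 * A) G t).
- by rewrite coefB coef1 coef_natM c0 mulr0 subr0.
- rewrite /G.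
  (* The linear part has X-coefficient 1728 - 720 - 1008 = 0, and the remaining terms start at
     X^2. *)
  have -> : 1728 * D - ((1 + 240 * B) ^+ 3 - (1 - 504 * C) ^+ 2)
    = 1728 * D - 720 * B - 1008 * C - B * B * (3 * 240 ^+ 2 + 240 ^+ 3 * B)
      + C * C * 504 ^+ 2 by ring.
  rewrite !(coefB, coefD, coef_natM) coef1_Delta !c1.
  have sq (f g : {poly int}) : f`_0 = 0 -> (f * f * g)`_1 = 0.
    move=> f0; rewrite coefM big_ord_recl big_ord1 !coefM !(big_ord1, big_ord_recl).
    by rewrite /= !f0; ring.
  by rewrite !sq ?c0.
have HB : 30 * theta B = 21 * C + 10 * B - A - 240 * (A * B) + 'X^N * u.
  by rewrite Eu; ring.
have HC : 42 * theta C = A + 21 * C + 20 * B - (504 * (A * C) - 2400 * (B * B)) + 'X^N * v.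
  by rewrite Ev; ring.
have -> : theta G = 1728 * theta D - 24 * (1 + 240 * B) ^+ 2 * (30 * theta B)
    - 24 * (1 - 504 * C) * (42 * theta C).
  by rewrite !(thetaB, thetaD, thetaM, thetaX, theta_nat, (theta_nat 1)) /=; ring.
by rewrite HB HC Ew /G /t; ring.
Qed.

(** * Congruences for tau *)

(** Modulo 7, E_6 = 1 because 7 divides 504, so the equation for E_6 gives E_2 = E_4^2. The equation
    for E_4 then reads 720 theta B = E_4^3 - 1 = 1728 Delta, and 720 and 1728 are both -1. *)
Lemma tau_congr7 (n : nat) : (0 < n)%N -> congr_mod 7 (tau n) (n%:R * sigma 3 n).
Proof.
move=> n0; have [r Er] := Delta_E4_E6 n.+1 n0.
have [u Eu] := theta_sigma3 n.+1; have [v Ev] := theta_sigma5 n.+1.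
(* [tau n] is by definition a coefficient of the product truncated at N = n + 1. *)
rewrite -/(Delta_poly n.+1)`_n.
set A := sigma_poly _ 1 in Eu Ev; set B := sigma_poly _ 3 in Er Eu Ev.
set C := sigma_poly _ 5 in Er Eu Ev; set D := Delta_poly _ in Er *.
pose P := 1 - 24 * A; pose Q := 1 + 240 * B; pose R := 1 - 504 * C.
(* The constants are 1729 / 7, 721 / 7, 1008 / 7 and 504 / 7. *)
pose W := 247 * D - 103 * theta B - 144 * Q * theta C + 72 * C * (P * Q - R).
have HB : 30 * theta B = 21 * C + 10 * B - A - 240 * (A * B) + 'X^(n.+1) * u.
  by rewrite Eu; ring.
have HC : 42 * theta C = A + 21 * C + 20 * B - (504 * (A * C) - 2400 * (B * B)) + 'X^(n.+1) * v.
  by rewrite Ev; ring.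
have E : D - theta B = 7 * W + 'X^(n.+1) * (24 * u + 24 * Q * v - r).
  have -> : D - theta B = 7 * W + (24 * (30 * theta B) + 24 * Q * (42 * theta C)
      - 504 * C * (P * Q - R) - 1728 * D) by rewrite /W; ring.
  by rewrite Er HB HC /P /Q /R; ring.
exists W`_n; have := congr1 (fun f : {poly int} => f`_n) E.
by rewrite coefB coef_theta coefD coefXnM ltnSn addr0 coef_natM !coef_poly ltnSn.
Qed.

(** Modulo 5, E_4 = 1 because 5 divides 240, so the equation for E_4 gives E_2 = E_6. The equation
    for E_2 then reads -288 theta A = E_6^2 - E_4^3 = -1728 Delta, and 288 and 1728 are both 3. *)
Lemma tau_congr5 (n : nat) : (0 < n)%N -> congr_mod 5 (tau n) (n%:R * sigma 1 n).
Proof.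
move=> n0; have [r Er] := Delta_E4_E6 n.+1 n0.
have [q Eq] := theta_sigma1 n.+1; have [u Eu] := theta_sigma3 n.+1.
rewrite -/(Delta_poly n.+1)`_n.
set A := sigma_poly _ 1 in Eq Eu *; set B := sigma_poly _ 3 in Er Eq Eu *.
set C := sigma_poly _ 5 in Er Eu *; set D := Delta_poly _ in Er *.
pose P := 1 - 24 * A; pose Q := 1 + 240 * B; pose R := 1 - 504 * C.
(* The relation is doubled, since 576 = 5 * 115 + 1 and 3456 = 5 * 691 + 1. *)
pose W := 115 * theta A - 691 * D + 96 * B * Q * (Q + 1)
  + 2 * (144 * theta B - 48 * P * B) * (P + R).
have HA : 6 * theta A = 5 * B + A - 12 * (A * A) + 'X^(n.+1) * q.
  by rewrite Eq; ring.
have HB : 30 * theta B = 21 * C + 10 * B - A - 240 * (A * B) + 'X^(n.+1) * u.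
  by rewrite Eu; ring.
have E : D - theta A = 5 * W + 'X^(n.+1) * (2 * r - 96 * q - 48 * u * (P + R)).
  have -> : D - theta A = 5 * W + (2 * (1728 * D) - 96 * (6 * theta A)
      - 480 * B * Q * (Q + 1) - 2 * (24 * (30 * theta B) - 240 * P * B) * (P + R)).
    by rewrite /W; ring.
  by rewrite Er HA HB /P /Q /R; ring.
exists W`_n; have := congr1 (fun f : {poly int} => f`_n) E.
by rewrite coefB coef_theta coefD coefXnM ltnSn addr0 coef_natM !coef_poly ltnSn.
Qed.

(* Eliminating sigma_5 to first order from Delta = (E_4^3 - E_6^2) / 1728 by
   Ramanujan's equations gives, with A, B, C generating sigma_1, sigma_3, sigma_5,
   Delta = theta^2 A - A^2 + 12 A theta A + 16 A^3 + 100 B^2 + 8000 B^3 - 147 C^2,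
   in which A + 5 B is divisible by 3. *)
Lemma tau_congr3_sqr (n : nat) : (0 < n)%N -> congr_mod 3 (tau n) (n%:R ^+ 2 * sigma 1 n).
Proof.
move=> n0; have [r Er] := Delta_E4_E6 n.+1 n0.
have [q Eq] := theta_sigma1 n.+1; have [u Eu] := theta_sigma3 n.+1.
rewrite -/(Delta_poly n.+1)`_n.
set A := sigma_poly _ 1 in Eq Eu *; set B := sigma_poly _ 3 in Er Eq Eu *.
set C := sigma_poly _ 5 in Er Eu *; set D := Delta_poly _ in Er *.
pose F := - A ^+ 2 + 12 * A * theta A + 16 * A ^+ 3 + 100 * B ^+ 2 + 20 ^+ 3 * B ^+ 3
  - 147 * C ^+ 2.
have Z1 : 21 * C + 10 * B - A - 30 * theta B + 'X^(n.+1) * u - 240 * (A * B) = 0.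
  by rewrite Eu; ring.
have Z2 : 5 * B + A - 6 * theta A + 'X^(n.+1) * q - 12 * (A * A) = 0.
  by rewrite Eq; ring.
have Z3 : 5 * theta B + theta A - 6 * theta (theta A)
    + 'X^(n.+1) * (n.+1%:R * q + theta q) - 24 * A * theta A = 0.
  have := congr1 theta Z2.
  rewrite !(thetaB, thetaD) theta_mulXn !thetaM !theta_nat.
  rewrite (_ : theta 0 = 0); last exact: (theta_nat 0).
  by move=> <-; ring.
have E1 : 1728 * (3 * (D - theta (theta A) - F))
    = 'X^(n.+1) * (3 * r - 144 * u - 144 * (1 + 48 * A) * q - 864 * (n.+1%:R * q + theta q)).
  transitivity (3 * (1728 * D) - 1728 * 3 * (theta (theta A) + F)); first by ring.
  rewrite Er; apply/eqP; rewrite -subr_eq0; apply/eqP.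
  (* 144 Z1 removes the linear term in C, 144 (1 + 48 A) Z2 those in B and A B, and 864 Z3 the theta
     B thus introduced. *)
  rewrite -[RHS](mulr0 144) -{1}Z1.
  rewrite -[LHS]subr0 -(mulr0 (144 * (1 + 48 * A))) -{1}Z2.
  rewrite -[LHS]subr0 -(mulr0 864) -{1}Z3 /F.
  by move: (theta (theta A)) (theta A) (theta B) (theta q) => *; ring.
(* By Z2, 3 T agrees with A + 5 B modulo X^N. Replacing A by S = 3 T - 5 B in the terms -A^2 and 16
   A^3 makes F visibly divisible by 3. *)
pose T := 2 * theta A + 4 * A ^+ 2.
pose W := 10 * T * B - 3 * T ^+ 2 + 25 * B ^+ 2
  + 16 * (9 * T ^+ 3 - 45 * T ^+ 2 * B + 75 * T * B ^+ 2 + 125 * B ^+ 3)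
  + 4 * A * theta A - 49 * C ^+ 2.
pose S := 3 * T - 5 * B.
have E2 : F = 3 * W + 'X^(n.+1) * (q * (S + A - 16 * (S ^+ 2 + S * A + A ^+ 2))).
  have HX : 'X^(n.+1) * q = S - A by rewrite -[LHS]subr0 -Z2 /S /T; ring.
  by rewrite mulrA HX /F /W /S; ring.
exists W`_n; have := congr1 (fun f : {poly int} => f`_n) E1.
rewrite /= E2 !(coef_natM, coefB, coefD, coef_theta, coefXnM) ltnSn addr0.
rewrite coef_poly ltnSn => /eqP; rewrite !mulf_eq0 /= subr_eq0 => /eqP <-.
by ring.
Qed.

(** * Eisenstein coefficients modulo p *)

Section CongrMod.
Context {R : comNzRingType} {p : nat}.
Implicit Types x y z : R.

Lemma congr_mod_refl x : congr_mod p x x.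
Proof. by exists 0; rewrite mulr0 subrr. Qed.

Lemma congr_mod_sym x y : congr_mod p x y -> congr_mod p y x.
Proof. by case=> z e; exists (- z); rewrite mulrN -e opprB. Qed.

Lemma congr_mod_trans x y z : congr_mod p x y -> congr_mod p y z -> congr_mod p x z.
Proof. by move=> [u eu] [v ev]; exists (u + v); rewrite mulrDr -eu -ev; ring. Qed.

Lemma congr_modD x y x' y' :
  congr_mod p x y -> congr_mod p x' y' -> congr_mod p (x + x') (y + y').
Proof. by move=> [u eu] [v ev]; exists (u + v); rewrite mulrDr -eu -ev; ring. Qed.

Lemma congr_modM x y x' y' :
  congr_mod p x y -> congr_mod p x' y' -> congr_mod p (x * x') (y * y').
Proof.
move=> [u eu] [v ev]; exists (u * x' + y * v).
by rewrite mulrDr mulrA -eu mulrCA -ev; ring.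
Qed.

Lemma congr_modX x y n : congr_mod p x y -> congr_mod p (x ^+ n) (y ^+ n).
Proof.
move=> xy; elim: n => [|n IHn]; first exact: congr_mod_refl.
by rewrite !exprS; apply: congr_modM.
Qed.

Lemma congr_mod_sum (I : eqType) (s : seq I) (F G : I -> R) :
  {in s, forall i, congr_mod p (F i) (G i)} ->
  congr_mod p (\sum_(i <- s) F i) (\sum_(i <- s) G i).
Proof.
move=> FG; rewrite big_seq [X in congr_mod _ _ X]big_seq.
apply: (big_ind2 (congr_mod p)) => //; first exact: congr_mod_refl.
exact: congr_modD.
Qed.

Lemma congr_mod_natr (m n : nat) : m = n %[mod p] -> congr_mod p m%:R (n%:R : R).
Proof.
move=> mn; exists ((m %/ p)%N%:R - (n %/ p)%N%:R).
rewrite {1}(divn_eq m p) {1}(divn_eq n p) mn !natrD !natrM; ring.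
Qed.

Lemma congr_mod_intr (m n : int) : congr_mod p m n -> congr_mod p m%:~R (n%:~R : R).
Proof. by case=> z e; exists z%:~R; rewrite -intrB e rmorphM /= rmorph_nat. Qed.

End CongrMod.

(** As p may divide d, Fermat's theorem is used in the form d^p = d, which absorbs one factor d and
    so calls for positive exponents. *)
Lemma expn_mod_period (p d e f : nat) : prime p -> (0 < e)%N -> (0 < f)%N ->
  e = f %[mod p - 1] -> (d ^ e = d ^ f %[mod p])%N.
Proof.
move=> pp; wlog ef : e f / (e <= f)%N => [wl e0 f0 /eqP E|].
  case: (leqP e f) => [ef|/ltnW fe]; first by apply: wl => //; apply/eqP.
  by symmetry; apply: wl => //; apply/eqP; rewrite eq_sym.
move=> e0 _ /eqP; rewrite eq_sym eqn_mod_dvd // => /dvdnP[t].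
move/(congr1 (addn e)); rewrite subnKC // => ->.
elim: t => [|t IHt]; first by rewrite addn0.
have -> : (e + t.+1 * (p - 1) = (e + t * (p - 1)).-1 + p)%N.
  by have := prime_gt0 pp; rewrite mulSn; move: (t * _)%N => u; lia.
rewrite IHt [in RHS]expnD -[RHS]modnMmr fermat_little // [RHS]modnMmr -expnSr prednK //.
by rewrite addn_gt0 e0.
Qed.

Lemma big_divisors_quotient (V : nmodType) (n : nat) (F : nat -> V) : (0 < n)%N ->
  \sum_(d <- divisors n) F (n %/ d)%N = \sum_(d <- divisors n) F d.
Proof.
move=> n0; rewrite -(big_map (divn n) xpredT); apply: perm_big.
have invK : {in divisors n, cancel (divn n) (divn n)}.
  move=> d; rewrite -dvdn_divisors // => dn.
  by rewrite -{1}(divnK dn) mulKn // divn_gt0 ?(dvdn_leq n0) // (dvdn_gt0 n0).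
have inD d : d \in divisors n -> (n %/ d)%N \in divisors n.
  by rewrite -!dvdn_divisors // => dn; apply/dvdnP; exists d; rewrite mulnC divnK.
apply: uniq_perm; rewrite ?map_inj_in_uniq ?divisors_uniq //.
  exact: can_in_inj invK.
move=> d; apply/mapP/idP => [[e en ->]|dn]; first exact: inD.
by exists (n %/ d)%N; rewrite ?inD // invK.
Qed.

(* For n = 2 mod 3 the divisors d and n / d cancel modulo 3 in sigma(n). *)
Lemma tau_congr3 (n : nat) : (0 < n)%N -> congr_mod 3 (tau n) (n%:R * sigma 1 n).
Proof.
move=> n0; apply: congr_mod_trans (tau_congr3_sqr n n0) _.
(* For n = 0 or 1 modulo 3 one has n^2 = n; for n = 2 both sides vanish because sigma(n) does. *)
have [n3|n3] := eqVneq (n %% 3)%N 2%N; last first.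
  apply: congr_modM; last exact: congr_mod_refl.
  rewrite -natrX; apply: congr_mod_natr; rewrite -modnXm.
  by have := ltn_pmod n (isT : 0 < 3)%N; case: (n %% 3)%N n3 => [|[|[|]]].
suff s0 : congr_mod 3 (sigma 1 n) 0.
  apply: (congr_mod_trans _ 0).
    rewrite -[X in congr_mod _ _ X](mulr0 (n%:R ^+ 2)).
    by apply: congr_modM => //; apply: congr_mod_refl.
  rewrite -(mulr0 n%:R); apply: congr_modM; first exact: congr_mod_refl.
  exact: congr_mod_sym.
have : congr_mod 3 (2 * sigma 1 n) 0.
  have -> : 2 * sigma 1 n = \sum_(d <- divisors n) (d + n %/ d)%N%:R.
    rewrite sigmaE // mulrDl !mul1r -{2}(big_divisors_quotient _ _ _ n0) -big_split.
    by apply: eq_bigr => d _; rewrite !expr1 natrD.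
  have {2}-> : (0 : int) = \sum_(d <- divisors n) 0 by rewrite big1_eq.
  apply: congr_mod_sum => d; rewrite -dvdn_divisors // => dn.
  apply: (congr_mod_natr _ 0); apply/eqP; rewrite mod0n -modnDm.
  have := n3; rewrite -{1}(divnK dn) -modnMm.
  have := ltn_pmod (n %/ d) (isT : 0 < 3)%N; have := ltn_pmod d (isT : 0 < 3)%N.
  by case: (d %% 3)%N => [|[|[|]]] //; case: (_ %% 3)%N => [|[|[|]]].
(* From 2 sigma = 3 z follows sigma = 3 sigma - 2 sigma = 3 (sigma - z). *)
case=> z e; exists (sigma 1 n - z).
by rewrite mulrBr -e; ring.
Qed.

(** Positivity of a matters at multiples of p, where the trivial character is 0 but m^0 = 1. *)
Lemma char_pow_congr (R : comNzRingType) (p : nat) (omega : nat -> R) (a m : nat) :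
  teichmuller_char p omega -> (0 < a)%N -> congr_mod p (char_pow p omega a m) (m ^ a)%N%:R.
Proof.
case=> _ _ _ om0 om a0; rewrite /char_pow -[a == 0%N]leqn0 leqNgt a0 natrX /=.
apply: congr_modX; have [pm|/om[_ //]] := boolP (p %| m)%N.
rewrite om0 //; apply: (congr_mod_natr 0 m).
by rewrite mod0n; symmetry; apply/eqP.
Qed.

Lemma eis_coef_congr (R : comNzRingType) (p : nat) (omega : nat -> R) (k a b n : nat) :
  teichmuller_char p omega -> (2 <= k)%N -> (0 < a)%N ->
  congr_mod p (eis_coef p omega k a b n)
    (\sum_(d <- divisors n) ((n %/ d) ^ a * d ^ (b + k).-1)%N%:R).
Proof.
move=> teich k2 a0; apply: congr_mod_sum => d _.
have -> : (b + k).-1 = (b + k.-1)%N by lia.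
rewrite expnD !natrM -mulrA; apply: congr_modM; first exact: char_pow_congr.
(* For b = 0 the trivial character kills the d divisible by p, which is harmless: k >= 2 makes
   d^(k-1) vanish modulo p there. *)
have [->|b0] := posnP b; last first.
  rewrite -natrX; apply: congr_modM; last exact: congr_mod_refl.
  exact: char_pow_congr.
rewrite mul1r -natrX /char_pow /=; case: ifP => [pd|_]; last first.
  by rewrite mul1r; apply: congr_mod_refl.
rewrite mul0r; apply: (congr_mod_natr 0); rewrite mod0n; symmetry; apply/eqP.
by apply: dvdn_exp pd; lia.
Qed.

(* Modulo p the two cases of the theorem give the terms n d^j and n (n/d)^j. *)
Lemma eis_coef_congr_sigma (R : comNzRingType) (p : nat) (omega : nat -> R)
    (k a b n j : nat) :
  prime p -> teichmuller_char p omega -> (2 <= k)%N -> (0 < n)%N ->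
  (a == 1)%N && (b + k == j.+2 %[mod p - 1])%N
    || (a == j.+1)%N && (b + k == 2 %[mod p - 1])%N ->
  congr_mod p (eis_coef p omega k a b n) (n%:R * sigma j n)%:~R.
Proof.
move=> pp teich k2 n0 ab.
have a0 : (0 < a)%N by case/orP: ab => /andP[/eqP ->].
apply: congr_mod_trans (eis_coef_congr _ _ _ _ _ b n teich k2 a0) _.
have expd d t : (b + k == t.+2 %[mod p - 1])%N -> (d ^ (b + k).-1 = d ^ t.+1 %[mod p])%N.
  move=> bk; apply: expn_mod_period => //.
    by rewrite -subn1 subn_gt0 (leq_trans k2) ?leq_addl.
  by apply/eqP; rewrite -(eqn_modDl 1) !add1n prednK // addn_gt0 (ltnW k2) orbT.
rewrite intrM mulrz_nat sigmaE // rmorph_sum mulr_sumr /=.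
case/orP: ab => /andP[/eqP -> bk].
  apply: congr_mod_sum => d; rewrite -dvdn_divisors // => dn.
  rewrite rmorphXn /= mulrz_nat -natrX -natrM; apply: congr_mod_natr.
  by rewrite -modnMmr (expd d _ bk) modnMmr expn1 expnS mulnA divnK.
(* In the second case the terms are n (n/d)^j, so the divisor sum is reindexed by d -> n/d. *)
rewrite -[X in congr_mod _ _ X](big_divisors_quotient _ n) //.
apply: congr_mod_sum => d; rewrite -dvdn_divisors // => dn.
rewrite rmorphXn /= mulrz_nat -natrX -natrM; apply: congr_mod_natr.
by rewrite -modnMmr (expd d _ bk) modnMmr expn1 expnSr -mulnA divnK // mulnC.
Qed.

Theorem theorem3p1 (p : nat) (R : comNzRingType) (omega : nat -> R) :
  p \in [:: 3%N; 5%N; 7%N] ->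
  teichmuller_char p omega ->
  forall k a b n : nat,
    (2 <= k)%N -> (1 <= a)%N -> (a <= p - 1)%N -> (b <= p - 1)%N ->
    (1 <= n)%N ->
    ((p \in [:: 3%N; 5%N]) ->
       (a == 1)%N && (b + k == 3 %[mod p - 1])%N
       || (a == 2)%N && (b + k == 2 %[mod p - 1])%N ->
       congr_mod p ((tau n)%:~R) (eis_coef p omega k a b n)) /\
    (p = 7%N ->
       (a == 1)%N && (b + k == 5 %[mod 6])%N
       || (a == 4)%N && (b + k == 2 %[mod 6])%N ->
       congr_mod p ((tau n)%:~R) (eis_coef p omega k a b n)).
Proof.
move=> _ teich k a b n k2 _ _ _ n0; split=> [p35 ab|p7 ab].
  have pp : prime p by move: p35; rewrite !inE => /orP[] /eqP ->.
  (* j = 1 matches both alternatives: b + k = j + 2 with a = 1, and a = j + 1 = 2. For p = 7 below,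
     j = 3 yields 5 and 4. *)
  have := eis_coef_congr_sigma _ _ _ _ _ _ _ 1 pp teich k2 n0 ab.
  move/congr_mod_sym; apply: congr_mod_trans.
  apply: congr_mod_intr; move: p35; rewrite !inE => /orP[] /eqP ->.
    exact: tau_congr3.
  exact: tau_congr5.
subst p.
have := eis_coef_congr_sigma _ _ _ _ _ _ _ 3 (isT : prime 7) teich k2 n0 ab.
move/congr_mod_sym; apply: congr_mod_trans.
by apply: congr_mod_intr; apply: tau_congr7.
Qed.
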